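(* Let $K\subseteq\mathbf{R}^n$ be a nonempty closed set and let $f=(f_1,\dots,f_s):\mathbf{R}^n\to\mathbf{R}^s$ be a vector polynomial with $\deg f_i=d_i\ge 1$ for $i=1,\dots,s$. Then: (i) $SOL^{w}(K_\infty,f^\infty)=\{0\}$ if and only if $SOL(K_\infty,f^\infty_i)=\{0\}$ for all $i\in\{1,\dots,s\}$. (ii) If $SOL^{s}(K_\infty,f^\infty)=\{0\}$, then $SOL(K_\infty,f^\infty_i)\neq\emptyset$ for all $i\in\{1,\dots,s\}$.
   Context: $\mathbf{R}^s_+$ is the nonnegative orthant. For a nonempty closed set $C\subseteq\mathbf{R}^n$ and a vector polynomial $h:\mathbf{R}^n\to\mathbf{R}^s$, $SOL^{s}(C,h)$ (Pareto efficient solutions) is the set of $x^*\in C$ such that $h(x)-h(x^* )\notin-\mathbf{R}^s_+\setminus\{0\}$ for all $x\in C$, and $SOL^{w}(C,h)$ (weak Pareto efficient solutions) is the set of $x^*\in C$ such that $h(x)-h(x^* )\notin-\mathrm{int}\,\mathbf{R}^s_+$ for all $x\in C$. For a scalar polynomial $q$, $SOL(C,q)$ is the set of global minimizers of $q$ over $C$. The asymptotic cone of $K$ is $K_\infty=\{v\in\mathbf{R}^n:\text{ there exist } t_k\to+\infty \text{ and } x_k\in K \text{ with } x_k/t_k\to v\}$. For a vector polynomial $p=(p_1,\dots,p_s)$ with $\deg p_i=d_i$, $p^\infty=(p_1^\infty,\dots,p_s^\infty)$ where $p_i^\infty(x)=\lim_{\lambda\to+\infty}p_i(\lambda x)/\lambda^{d_i}$.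 *)

(* Defs.v *)
From HB Require Import structures.
From mathcomp Require Import all_boot all_order all_algebra.
From mathcomp Require Import all_classical all_reals all_analysis.
(* The notations of [mpoly] clash with those of MathComp-Analysis, so only its
   canonical structures and coercions are imported. *)
From mathcomp Require mpoly.
Import (canonicals, coercions) mpoly.

Set Implicit Arguments.
Unset Strict Implicit.
Unset Printing Implicit Defensive.

Import Order.TTheory GRing.Theory Num.Theory.
Import numFieldNormedType.Exports.

Local Open Scope classical_set_scope.
Local Open Scope ring_scope.

Definition nonneg_orthant (R : realType) (s : nat) : set 'rV[R]_s :=
  [set y | forall i, 0 <= y ord0 i].

Definition pareto_sol (R : realType) (n s : nat)
    (C : set 'rV[R]_n) (h : 'rV[R]_n -> 'rV[R]_s) : set 'rV[R]_n :=
  [set xs | C xs /\ forall x, C x ->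
     ~ ([set - y | y in @nonneg_orthant R s] `\ 0) (h x - h xs)].

Definition weak_pareto_sol (R : realType) (n s : nat)
    (C : set 'rV[R]_n) (h : 'rV[R]_n -> 'rV[R]_s) : set 'rV[R]_n :=
  [set xs | C xs /\ forall x, C x ->
     ~ [set - y | y in interior (@nonneg_orthant R s)] (h x - h xs)].

Definition scalar_sol (R : realType) (n : nat)
    (C : set 'rV[R]_n) (q : 'rV[R]_n -> R) : set 'rV[R]_n :=
  [set xs | C xs /\ forall x, C x -> q xs <= q x].

Definition asymptotic_cone (R : realType) (n : nat) (K : set 'rV[R]_n) :
    set 'rV[R]_n :=
  [set v | exists (t : nat -> R) (x : nat -> 'rV[R]_n),
     [/\ t k @[k --> \oo] --> +oo,
         forall k, K (x k) &
         (t k)^-1 *: x k @[k --> \oo] --> v]].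

(* [msize p] is the total degree plus one, and 0 for [p = 0]; thus the zero
   polynomial gets degree 0 here, like the nonzero constants. *)
Definition mpoly_degree (R : realType) (n : nat) (p : mpoly.mpoly n R) : nat :=
  (mpoly.msize p).-1.

Definition mpoly_fun (R : realType) (n : nat) (p : mpoly.mpoly n R)
    (x : 'rV[R]_n) : R :=
  mpoly.meval (fun i : 'I_n => x ord0 i) p.

Definition recession (R : realType) (n : nat) (p : mpoly.mpoly n R)
    (x : 'rV[R]_n) : R :=
  lim (mpoly_fun p (l *: x) / l ^+ mpoly_degree p @[l --> +oo]).

Definition vrecession (R : realType) (n s : nat)
    (f : 'I_s -> mpoly.mpoly n R) (x : 'rV[R]_n) : 'rV[R]_s :=
  \row_(i < s) recession (f i) x.

(* Main.v *)
(* Write C for the asymptotic cone, a closed cone, and F_i for the recession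
   functions, which are continuous and positively homogeneous of positive degree.
   A nonzero w in C with all F_i w <= 0 would be a (weak) Pareto point once 0 is
   one; so if 0 is the only such point, every nonzero w in C has some F_i w > 0.
   By homogeneity and compactness of the unit sphere this makes every set
   {y in C | F y <= F v} compact, and minimizing sum_i F_i over it gives a Pareto
   point y with F y <= F v.  Uniqueness forces y = 0, hence F v >= 0 for every v
   in C. *)

Require Import Defs.
From mathcomp Require Import all_boot all_order all_algebra.
From mathcomp Require Import all_classical all_reals all_analysis.
From mathcomp Require mpoly.
Import (canonicals, coercions) mpoly.
Import Order.TTheory GRing.Theory Num.Theory.
Import numFieldNormedType.Exports.

Local Open Scope classical_set_scope.
Local Open Scope ring_scope.

(** * Recession functions as leading homogeneous parts *)

(** Dividing by [l ^+ d] kills every monomial of degree below [d] in the limit. Continuity and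
    homogeneity are then read off the finite sum. *)
Lemma recessionE (R : realType) (n : nat) (p : mpoly.mpoly n R) (x : 'rV[R]_n) :
  recession p x =
    \sum_(m <- mpoly.msupp p | mpoly.mdeg m == mpoly_degree p)
       mpoly.mcoeff m p * \prod_(i < n) x ord0 i ^+ m i.
Proof.
set d := mpoly_degree p.
(* For [l != 0], [p (l x) / l ^+ d] is a polynomial in [l^-1]. *)
pose q := \sum_(m <- mpoly.msupp p)
  ((mpoly.mcoeff m p * \prod_(i < n) x ord0 i ^+ m i) *: 'X^(d - mpoly.mdeg m)).
have deg_le m : m \in mpoly.msupp p -> (mpoly.mdeg m <= d)%N.
  by move=> /mpoly.msize_mdeg_lt; rewrite /d /mpoly_degree; case: (mpoly.msize p).
(* At 0 only the terms with exponent [d - mdeg m = 0] survive; by [deg_le] these are exactly the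
   monomials of degree [d], despite truncated subtraction. *)
have -> : \sum_(m <- mpoly.msupp p | mpoly.mdeg m == d)
    mpoly.mcoeff m p * \prod_(i < n) x ord0 i ^+ m i = q.[0].
  rewrite horner_sum big_mkcond; apply: eq_big_seq => m /deg_le md.
  rewrite hornerZ hornerXn expr0n subn_eq0 eqn_leq md.
  by case: leqP => _; rewrite ?mulr1 ?mulr0.
apply/cvg_lim => //.
have inv0 : (l^-1 : R) @[l --> +oo] --> (0 : R).
  by apply/gtr0_cvgV0 => //; exact: nbhs_pinfty_gt.
apply: cvg_trans (cvg_comp _ _ inv0 (@continuous_horner R q 0)).
apply: near_eq_cvg; near=> l.
have l0 : l != 0 by apply: lt0r_neq0; near: l; exact: nbhs_pinfty_gt.
rewrite /mpoly_fun mpoly.mevalE /= horner_sum mulr_suml.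
apply: eq_big_seq => m /deg_le md.
rewrite hornerZ hornerXn -!mulrA; congr (_ * _).
under [in RHS]eq_bigr do rewrite mxE exprMn.
rewrite big_split /= prodrXr -mpoly.mdegE mulrAC mulrC; congr (_ * _).
rewrite exprVn -[X in _ / _ ^+ X](subnK md) exprD invfM mulrCA.
by rewrite mulfV ?mulr1// expf_neq0.
Unshelve. all: by end_near. Qed.

Lemma recession_continuous (R : realType) (n : nat) (p : mpoly.mpoly n R) :
  continuous (recession p).
Proof.
rewrite (funext (@recessionE R n p)).
apply: (continuous_big add_continuous) => m _ x.
apply: (@cvgM _ _ (nbhs x)); first exact: cvg_cst.
apply: (continuous_big mul_continuous) => i _ y.
by apply: (@continuous_comp _ _ _ (fun z : 'rV[R]_n => z ord0 i)
    (fun r : R => r ^+ m i)); [exact: coord_continuous|exact: exprn_continuous].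
Qed.

Lemma recessionZ (R : realType) (n : nat) (p : mpoly.mpoly n R) (a : R)
    (x : 'rV[R]_n) :
  recession p (a *: x) = a ^+ mpoly_degree p * recession p x.
Proof.
rewrite !recessionE mulr_sumr; apply: eq_bigr => m /eqP <-.
under eq_bigr do rewrite mxE exprMn.
by rewrite big_split /= prodrXr -mpoly.mdegE mulrCA.
Qed.

(** * The asymptotic cone is a closed cone containing 0 *)

(** Trading the sequences for one approximation per [e] reduces closedness to a triangle inequality,
    without a diagonal extraction. *)
Lemma asymptotic_coneP (R : realType) (n : nat) (K : set 'rV[R]_n) (v : 'rV[R]_n) :
  asymptotic_cone K v <->
  forall e : R, 0 < e ->
    exists t x, [/\ e^-1 < t, K x & `|v - t^-1 *: x| < e].
Proof.
split=> [[t [x [tK xK cv]]] e e0|H].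
  move/cvgrPdist_lt : cv => /(_ e e0) cv.
  move/cvgryPgt : tK => /(_ e^-1) tK.
  near \oo => k; exists (t k), (x k); split => //; near: k; [exact: tK|exact: cv].
have /choice[tx txP] : forall k : nat, exists tx : R * 'rV[R]_n,
    [/\ k.+1%:R < tx.1, K tx.2 & `|v - tx.1^-1 *: tx.2| < k.+1%:R^-1].
  move=> k; have [|t [x [tk Kx vx]]] := H k.+1%:R^-1; first by rewrite invr_gt0.
  by exists (t, x); rewrite invrK in tk.
exists (fst \o tx), (snd \o tx); split => /=.
- apply/cvgryPgt => A; near=> k.
  have [+ _ _] := txP k; apply: le_lt_trans.
  by near: k; move/cvgryPge : (@cvgr_idn R) => /(_ A); apply: filterS => k /le_trans;
    apply; rewrite ler_nat.
- by move=> k; have [] := txP k.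
- apply/cvgrPdist_lt => e e0; near=> k.
  have [_ _ /lt_trans] := txP k; apply.
  by near: k; exact: (near_infty_natSinv_lt (PosNum e0)).
Unshelve. all: by end_near. Qed.

Lemma asymptotic_cone_closed (R : realType) (n : nat) (K : set 'rV[R]_n) :
  closed (asymptotic_cone K).
Proof.
move=> v clv; apply/asymptotic_coneP => e e0.
have e20 : 0 < e / 2 by rewrite divr_gt0.
have [w [/asymptotic_coneP/(_ _ e20)[t [x [et Kx wx]]]]] :=
  clv _ (nbhsx_ballx v _ e20).
rewrite -ball_normE /= => vw; exists t, x; split => //.
  apply: lt_trans et; rewrite ltf_pV2 ?posrE//.
  by rewrite ltr_pdivrMr// ltr_pMr// ltr1n.
by rewrite (splitr e) (le_lt_trans (ler_distD w _ _))// ltrD.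
Qed.

Lemma asymptotic_coneZ (R : realType) (n : nat) (K : set 'rV[R]_n) (a : R)
    (v : 'rV[R]_n) :
  0 < a -> asymptotic_cone K v -> asymptotic_cone K (a *: v).
Proof.
move=> a0 [t [x [too Kx xv]]]; exists (fun k => a^-1 * t k), x; split => //.
  apply/cvgryPgt => A; move/cvgryPgt : too => /(_ (a * A)).
  by apply: filterS => k; rewrite mulrC -ltr_pdivlMr// mulrC.
under eq_fun do rewrite invfM invrK -scalerA.
exact: cvgZr.
Qed.

Lemma asymptotic_cone0 (R : realType) (n : nat) (K : set 'rV[R]_n) :
  K !=set0 -> asymptotic_cone K 0.
Proof.
move=> [x Kx]; exists (fun k => k%:R), (fun=> x); split => //.
  exact: cvgr_idn.
rewrite -(scale0r x); apply: cvgZl.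
(* The shift skips [k = 0], where the inverse is 0 by convention. *)
rewrite -(@cvg_shiftS R^o); apply/gtr0_cvgV0; first exact: nearW.
by rewrite (@cvg_shiftS R^o); exact: cvgr_idn.
Qed.

(** * Coordinatewise form of the two efficiency notions *)

Lemma interior_nonneg_orthant (R : realType) (s : nat) (y : 'rV[R]_s) :
  interior (@nonneg_orthant R s) y <-> forall i, 0 < y ord0 i.
Proof.
split=> [/nbhs_ballP[e /= e0 ye] i|y0].
  (* Lowering every coordinate of [y] by [e / 2] stays inside the ball of radius [e], hence in the
     orthant. *)
  suff : 0 <= (y - const_mx (e / 2)) ord0 i.
    by rewrite !mxE subr_ge0; apply: lt_le_trans; rewrite divr_gt0.
  apply: ye; split => // i' j; rewrite !mxE /ball /= opprB addrCA subrr addr0.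
  by rewrite gtr0_norm ?divr_gt0// ltr_pdivrMr// ltr_pMr// ltr1n.
have : \forall z \near y, forall i, 0 < (z : 'rV[R]_s) ord0 i.
  apply: (@filter_forall _ _ _ (nbhs y)) => i.
  exact: (@coord_continuous R _ _ ord0 i y _ (lt_nbhsr (y0 i))).
by apply: filterS => z z0 i; exact/ltW.
Qed.

Lemma weak_pareto_solP (R : realType) (n s : nat) (C : set 'rV[R]_n)
    (h : 'rV[R]_n -> 'rV[R]_s) (x : 'rV[R]_n) :
  weak_pareto_sol C h x <->
  C x /\ forall z, C z -> ~ forall i, h z ord0 i < h x ord0 i.
Proof.
have E z : [set - y | y in interior (@nonneg_orthant R s)] (h z - h x) <->
    forall i, h z ord0 i < h x ord0 i.
  split=> [[y /interior_nonneg_orthant y0 yE] i|zx].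
    by have := y0 i; rewrite -[y]opprK yE !mxE opprB subr_gt0.
  exists (h x - h z); last by rewrite opprB.
  by apply/interior_nonneg_orthant => i; rewrite !mxE subr_gt0.
by split=> -[Cx H]; split=> // z Cz; have := H z Cz; rewrite E.
Qed.

Lemma pareto_solP (R : realType) (n s : nat) (C : set 'rV[R]_n)
    (h : 'rV[R]_n -> 'rV[R]_s) (x : 'rV[R]_n) :
  pareto_sol C h x <->
  C x /\ forall z, C z -> (forall i, h z ord0 i <= h x ord0 i) -> h z = h x.
Proof.
split=> -[Cx H]; split=> // z Cz.
  move=> zx; apply: contrapT => /eqP hzx; apply: (H z Cz); split; last first.
    by apply/eqP; rewrite subr_eq0.
  exists (h x - h z); last by rewrite opprB.
  by move=> i; rewrite !mxE subr_ge0.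
move=> [[y y0 yE] /eqP]; rewrite subr_eq0 => /eqP; apply; apply: H => // i.
by have := y0 i; rewrite -[y]opprK yE !mxE opprB subr_ge0.
Qed.

(** * Pareto points of homogeneous functions on a closed cone *)

Section cone.
Variables (R : realType) (n s : nat) (C : set 'rV[R]_n).
Variables (F : 'I_s -> 'rV[R]_n -> R) (d : 'I_s -> nat).
Hypothesis C_closed : closed C.
Hypothesis CZ : forall a x, 0 < a -> C x -> C (a *: x).
Hypothesis F_continuous : forall i, continuous (F i).
Hypothesis FZ : forall i a x, F i (a *: x) = a ^+ d i * F i x.
Hypothesis d_gt0 : forall i, (0 < d i)%N.
Hypothesis F_pos : forall w, C w -> w != 0 -> exists i, 0 < F i w.

(** The sum [psi] of the positive parts of the [F i] is at least some [c > 0] on unit vectors of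
    [C]. As all degrees are at least 1, [psi y] is at least [c] times the norm of [y] once that norm
    exceeds 1, while [psi] is at most [M = psi v] on the sublevel set. *)
Lemma sublevel_compact (v : 'rV[R]_n) :
  compact (C `&` [set y | forall i, F i y <= F i v]).
Proof.
apply: bounded_closed_compact; last first.
  apply: closedI => //.
  rewrite (_ : mkset _ = \bigcap_i (F i @^-1` [set r | r <= F i v])); last first.
    by apply/seteqP; split=> [y H i _|y H i]; [exact: H|exact: (H i I)].
  apply: closed_bigI => i _; apply: preimage_closed; last exact: closed_le.
  by move=> x _; exact: F_continuous.
pose S := C `&` [set u | `|u| = 1].
have S_compact : compact S.
  apply: bounded_closed_compact.
    by exists 1; split => // r r1 u [_ /= ->]; exact: ltW.
  apply: closedI => //.
  rewrite (_ : mkset _ = Num.norm @^-1` [set (1 : R)]) //.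
  apply: preimage_closed; last exact: closed_eq.
  by move=> x _; exact: norm_continuous.
(* [psi] replaces the maximum of the [F i]: it is positive as soon as one of them
   is, and continuous. *)
pose psi u := \sum_i Num.max (F i u) 0.
have psi_cont : continuous psi.
  apply: (continuous_big add_continuous) => i _ x.
  apply: (@continuous_max R _ (F i) (cst 0)); last exact: cst_continuous.
  exact: F_continuous.
have [c c0 psic] : exists2 c, 0 < c & forall u, S u -> c <= psi u.
  (* [S] is empty when [C] has no nonzero point, and then any [c] will do. *)
  have [S0|/set0P S_neq0] := eqVneq S set0.
    by exists 1 => // u; rewrite S0.
  have [w /[!inE] -[Cw w1] wmin] := compact_EVT_min S_neq0 S_compact
    (continuous_subspaceT psi_cont).
  exists (psi w); last by move=> u Su; apply: wmin; rewrite inE.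
  have [|i Fi] := F_pos w Cw; first by rewrite -normr_gt0 w1.
  rewrite /psi (bigD1 i) //= ltr_pwDl//; first by rewrite lt_max Fi.
  by apply: sumr_ge0 => j _; rewrite le_max lexx orbT.
pose M := \sum_i Num.max (F i v) 0.
exists (Num.max 1 (M / c)); split; first exact: num_real.
move=> r; rewrite gt_max => /andP[r1 Mr] y [Cy yv].
have [y1|y1] := leP `|y| 1; first exact: le_trans y1 (ltW r1).
have y0 : 0 < `|y| by rewrite (lt_trans _ y1).
have Su : S (`|y|^-1 *: y).
  split; first by apply: CZ; rewrite ?invr_gt0.
  by rewrite /= normrZ ger0_norm ?invr_ge0// mulVf// gt_eqF.
apply: (le_trans _ (ltW Mr)); rewrite ler_pdivlMr//.
apply: (@le_trans _ _ (`|y| * psi (`|y|^-1 *: y))).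
  by rewrite ler_wpM2l// psic.
rewrite /psi mulr_sumr; apply: ler_sum => i _.
rewrite maxr_pMr ?(ltW y0)// mulr0.
rewrite ge_max le_max [X in _ && X]le_max lexx orbT andbT.
(* A nonpositive value is absorbed by the 0 in the maximum. A positive one grows from factor [|y|]
   to [|y| ^+ d i], which gives [F i y]. *)
have [Fy|Fy] := leP (F i (`|y|^-1 *: y)) 0.
  by rewrite orbC pmulr_rle0// Fy.
rewrite (le_trans _ (yv i))// -[in leRHS](scale1r y) -(mulfV (lt0r_neq0 y0)).
rewrite -scalerA [in leRHS]FZ ler_wpM2r ?(ltW Fy)//.
by rewrite ler_eXnr // ltW.
Qed.

(** A point dominating the minimizer of the sum stays in the sublevel set, so one strict decrease
    would push the sum below its minimum. *)
Lemma exists_pareto_below (v : 'rV[R]_n) : C v ->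
  exists y, [/\ C y, forall i, F i y <= F i v &
    forall z, C z -> (forall i, F i z <= F i y) -> forall i, F i z = F i y].
Proof.
move=> Cv; set A := C `&` [set y | forall i, F i y <= F i v].
have A0 : A !=set0 by exists v; split.
have g_cont : continuous (fun y => \sum_i F i y).
  by apply: (continuous_big add_continuous) => i _; exact: F_continuous.
have [y /[!inE] -[Cy yv] ymin] := compact_EVT_min A0 (sublevel_compact v)
  (continuous_subspaceT g_cont).
exists y; split => // z Cz zy i; apply/eqP; apply: contrapT => /negP zyi.
have /ymin : z \in A by rewrite inE; split=> // j; exact: le_trans (yv j).
apply/negP; rewrite -ltNge (bigD1 i)//= [ltRHS](bigD1 i)//= ltr_leD//.
  by rewrite lt_neqAle zyi zy.
exact: ler_sum.
Qed.
End cone.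

Theorem theorem3p1 (R : realType) (n s : nat) (s_gt0 : (0 < s)%N)
    (K : set 'rV[R]_n) (f : 'I_s -> mpoly.mpoly n R)
    (K_nonempty : K !=set0) (K_closed : closed K)
    (f_degree : forall i : 'I_s, (1 <= mpoly_degree (f i))%N) :
  (weak_pareto_sol (asymptotic_cone K) (vrecession f) = [set 0] <->
     forall i : 'I_s, scalar_sol (asymptotic_cone K) (recession (f i)) = [set 0])
  /\
  (pareto_sol (asymptotic_cone K) (vrecession f) = [set 0] ->
     forall i : 'I_s, scalar_sol (asymptotic_cone K) (recession (f i)) !=set0).
Proof.
set C := asymptotic_cone K; pose F i := recession (f i).
have C0 : C 0 by exact: asymptotic_cone0.
have F0 i : F i 0 = 0.
  by rewrite -(scale0r 0) /F recessionZ expr0n gtn_eqF ?mul0r.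
have vF x i : vrecession f x ord0 i = F i x by rewrite mxE.
have pareto_below := @exists_pareto_below R n s C F (fun i => mpoly_degree (f i))
  (@asymptotic_cone_closed R n K) (@asymptotic_coneZ R n K)
  (fun i => @recession_continuous R n (f i))
  (fun i a x => @recessionZ R n (f i) a x) f_degree.
(* Shared by both parts: the first premise yields the positivity needed for compactness, the second
   collapses the Pareto point below [v] to 0. *)
have nonneg : (forall w, C w -> (forall i, F i w <= 0) -> w = 0) ->
    (forall y, C y -> (forall z, C z -> (forall i, F i z <= F i y) ->
       forall i, F i z = F i y) -> y = 0) ->
    forall i v, C v -> 0 <= F i v.
  move=> neg0 pareto0 i v Cv; have [w Cw w0|y [Cy yv /(pareto0 _ Cy) y0]] :=
    pareto_below _ v Cv.
    apply: contrapT => /forallNP wF; move/eqP : w0; apply; apply: neg0 => // j.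
    by rewrite leNgt; apply/negP/wF.
  by have := yv i; rewrite y0 F0.
split; [split|].
- move=> solE.
  have wsol x : C x -> (forall z, C z -> ~ forall i, F i z < F i x) -> x = 0.
    move=> Cx xmin; have : weak_pareto_sol C (vrecession f) x.
      apply/weak_pareto_solP; split=> // z Cz zx; apply: (xmin z Cz) => i.
      by rewrite -!vF.
    by rewrite solE.
  have [_ w0] : C 0 /\ forall z, C z -> ~ forall i, F i z < F i 0.
    have /weak_pareto_solP[_ H] : weak_pareto_sol C (vrecession f) 0.
      by rewrite solE.
    by split=> // z Cz zF; apply: (H z Cz) => i; rewrite !vF.
  have F_ge0 : forall i v, C v -> 0 <= F i v.
    (* A point strictly below [w] would be strictly below 0. A Pareto point [y] is weakly Pareto,
       since strict domination contradicts equality at the index [i0]. *)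
    apply: nonneg => [w Cw wF|y Cy ymin]; apply: wsol => // z Cz zF.
      by apply: (w0 z Cz) => i; rewrite F0 (lt_le_trans (zF i)).
    pose i0 := Ordinal s_gt0.
    have := zF i0; rewrite (ymin z Cz) ?ltxx// => i.
    exact/ltW.
  (* A minimizer of a single [F i] is weakly Pareto: nothing is strictly below it in coordinate
     [i]. *)
  move=> i; apply/seteqP; split => [x [Cx xmin]|_ ->].
    by apply: wsol => // z Cz /(_ i); apply/negP; rewrite -leNgt xmin.
  by split=> // x Cx; rewrite -/(F i 0) F0 F_ge0.
- move=> solE.
  have sol0 i : scalar_sol C (F i) 0 by rewrite solE.
  apply/seteqP; split => [x /weak_pareto_solP[Cx xmin]|_ ->].
    (* If [x] is nonzero, 0 strictly dominates it: equality [F i 0 = F i x] would make [x] a second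
       minimizer of [F i]. *)
    apply: contrapT => x0; apply: (xmin 0 C0) => i; rewrite !vF.
    have [_ H] := sol0 i; rewrite lt_neqAle H// andbT; apply/negP => /eqP E.
    apply: x0; rewrite -(solE i); split=> // z Cz; rewrite -/(F i x) -E.
    exact: H.
  apply/weak_pareto_solP; split => // z Cz /(_ (Ordinal s_gt0)).
  by have [_ /(_ z Cz)] := sol0 (Ordinal s_gt0); rewrite !vF leNgt => /negP.
- move=> solE.
  have psol x : C x -> (forall z, C z -> (forall i, F i z <= F i x) ->
      forall i, F i z = F i x) -> x = 0.
    move=> Cx xmin; have : pareto_sol C (vrecession f) x.
      apply/pareto_solP; split=> // z Cz zx; apply/rowP => i; rewrite !vF.
      by apply: xmin => // j; rewrite -!vF.
    by rewrite solE.
  have p0 z : C z -> (forall i, F i z <= 0) -> forall i, F i z = 0.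
    have /pareto_solP[_ H] : pareto_sol C (vrecession f) 0 by rewrite solE.
    move=> Cz zF i; rewrite -vF H// ?vF ?F0// => j.
    by rewrite !vF F0.
  move=> i; exists 0; split=> // x Cx; rewrite -/(F i 0) F0.
  (* If [F w <= 0], efficiency of 0 forces [F w = 0]; anything below [w] then also has value 0, so
     [w] is itself Pareto and hence 0. *)
  apply: (nonneg _ psol) => // w Cw wF; apply: psol => // z Cz zw j.
  have w0 := p0 w Cw wF.
  by rewrite w0; apply: p0 => // k; rewrite -(w0 k).
Qed.
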